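(* Let $G$ be a group and $A\subseteq G$. If $A$ is almost P-small or weakly P-small, then $G\setminus\Delta(A)$ is infinite.
   Context: For $A\subseteq G$, $\Delta(A)=\{g\in G:|gA\cap A|=\infty\}$. $A$ is almost P-small if there is an injective sequence $(g_n)_{n\in\omega}$ in $G$ such that $g_nA\cap g_mA$ is finite for all distinct $n,m$. $A$ is weakly P-small if for every $n\in\omega$ there exist distinct $g_1,\dots,g_n\in G$ such that $g_1A,\dots,g_nA$ are pairwise disjoint. *)

(* Defs.v *)
From mathcomp Require Import all_boot.
From mathcomp Require Import monoid boolp classical_sets functions cardinality.

Set Implicit Arguments.
Unset Strict Implicit.
Unset Printing Implicit Defensive.

Local Open Scope classical_set_scope.

(* [groupType] is the structure of arbitrary, possibly infinite, groups. *)

Definition ltranslate (G : groupType) (g : G) (A : set G) : set G :=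
  [set (g * x)%g | x in A].

Definition Delta (G : groupType) (A : set G) : set G :=
  [set g | infinite_set (ltranslate g A `&` A)].

Definition almost_P_small (G : groupType) (A : set G) : Prop :=
  exists2 g : nat -> G, injective g &
    forall n m : nat, n <> m ->
      finite_set (ltranslate (g n) A `&` ltranslate (g m) A).

Definition weakly_P_small (G : groupType) (A : set G) : Prop :=
  forall n : nat, exists2 g : 'I_n -> G, injective g &
    forall i j : 'I_n, i <> j ->
      ltranslate (g i) A `&` ltranslate (g j) A = set0.

(* Main.v *)
Require Import Defs.
From mathcomp Require Import all_boot.
From mathcomp Require Import monoid boolp classical_sets functions cardinality.

Local Open Scope classical_set_scope.

(** If [g_0 A, ..., g_n A] meet pairwise in finite sets, then the [n] distinct
elements [g_0^-1 g_i] with [i > 0] lie outside [Delta A]. Both forms of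
smallness provide such families of every finite length. *)

(** Left multiplication by [h^-1] carries [gA ∩ hA] onto [h^-1 g A ∩ A], and images of finite sets
    are finite. *)
Lemma finite_ltranslateI {G : groupType} (g h : G) (A : set G) :
  finite_set (ltranslate g A `&` ltranslate h A) ->
  finite_set (ltranslate (h^-1 * g)%g A `&` A).
Proof.
move=> /(finite_image (fun x => h^-1 * x)%g); apply: sub_finite_set.
move=> _ [[a Aa <-]] Aga; exists (g * a)%g; last by rewrite mulgA.
by split; [exists a | exists (h^-1 * g * a)%g; rewrite // -!mulgA mulVKg].
Qed.

Lemma infinite_setDDelta {G : groupType} (A : set G) :
  (forall n, exists2 g : 'I_n -> G, injective g &
     forall i j : 'I_n, i <> j ->
       finite_set (ltranslate (g i) A `&` ltranslate (g j) A)) ->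
  infinite_set ([set: G] `\` Delta A).
Proof.
move=> families /finite_seqP[s sE].
(* One translate, [g ord0], is the base point; the other [size s + 1] give distinct quotients, one
   too many to fit in [s]. *)
have [g g_inj finI] := families (size s).+2.
pose f (i : 'I_(size s).+1) := ((g ord0)^-1 * g (lift ord0 i))%g.
have f_inj : injective f by move=> i j /mulgI/g_inj/lift_inj.
suff /(uniq_leq_size _) : {subset codom f <= s}.
  by rewrite map_inj_uniq // enum_uniq size_codom card_ord ltnn => /(_ isT).
move=> _ /codomP[i ->]; suff : [set` s] (f i) by [].
(* Lying outside [Delta A] is a double negation of finiteness, so the bare [apply] leaves a
   finiteness goal. *)
rewrite -sE; split => //; apply; apply/finite_ltranslateI/finI.
by move/eqP; rewrite eq_sym (negPf (neq_lift _ _)).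
Qed.

Theorem theorem3p4 (G : groupType) (A : set G)
    (hA : almost_P_small A \/ weakly_P_small A) :
  infinite_set ([set: G] `\` Delta A).
Proof.
apply: infinite_setDDelta => n; case: hA => [[g g_inj finI] | /(_ n)[g g_inj disj]].
  exists (g \o @nat_of_ord n); first exact: inj_comp g_inj (@ord_inj n).
  by move=> i j ij; apply: finI => /ord_inj.
by exists g => // i j /disj ->.
Qed.
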